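(* Let $\Phi$ be a symplectic $S^1$ action on a symplectic manifold $(M,\omega)$ with compatible almost complex structure $J$, and let $p$ be a fixed point of $\Phi$. Then the local Maslov index $k_p=Q_\alpha(p)$, where $\alpha$ is a connection $1$-form on $\Gamma_J^2$, is an integer measuring how many times the orbit of the lifted action $\Phi_{\Gamma^2}$ through a point $w\in\pi_{\Gamma_J^2}^{-1}(p)$ winds around the fiber $\pi_{\Gamma_J^2}^{-1}(p)$ (i.e. $k_p$ is the degree of the map $\zeta:S^1\to S^1$ defined by $\Phi^z_{\Gamma^2}(w)=w\cdot\zeta(z)$), and it does not depend on the choice of $\alpha$.
   Context: Let $\dim M=2n$. $J$ is compatible with $\omega$ if $g_J(u,v)=\omega(Ju,v)$ is a Riemannian metric. A unitary frame of $T_pM$ is a basis $(u_1,\dots,u_n,v_1,\dots,v_n)$ with $v_i=-Ju_i$, $g_J(u_i,u_j)=\delta_{ij}$, $g_J(u_i,v_j)=0$. $\mathbb{U}(n)$ is identified with the real matrices $C=\begin{bmatrix} A & -B \\ B & A \end{bmatrix}$ with $A+iB$ unitary, acts on frames from the right, and $\det_{\mathbb C}C=\det(A+iB)$. $Fr^u_J\to M$ is the principal $\mathbb{U}(n)$-bundle of unitary frames, $\mathbb{EU}(n)=\{\det_{\mathbb C}=\pm1\}$, and $\pi_{\Gamma_J^2}:\Gamma_J^2=Fr^u_J/\mathbb{EU}(n)\to M$ is a principal $S^1$ bundle with inherent $S^1$ action $[f]\cdot z=[f\cdot C]$ for any $C$ with $(\det_{\mathbb C}C)^2=z$. Let $\frac{\partial}{\partial\theta}$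 generate $t\mapsto w\cdot e^{2\pi i t}$. A connection $1$-form on $\Gamma_J^2$ is $\alpha=f_\alpha\frac{\partial}{\partial\theta}$ with $f_\alpha$ a real $S^1$-invariant $1$-form with $f_\alpha(\frac{\partial}{\partial\theta})=1$. Lifted action: there is a $\Phi$-invariant compatible $J$, and unitary frame bundles of different compatible almost complex structures are isomorphic principal $\mathbb{U}(n)$-bundles over $M$. For invariant $J$, $\Phi^z_{\Gamma^2}[(u_1,\dots,v_n)]=[(\Phi^z_*u_1,\dots,\Phi^z_*v_n)]$, $z\in S^1$ (for general $J$, transport through such an isomorphism); it covers $\Phi$ and commutes with the inherent $S^1$ action. The Maslov data of $\Phi$ at $p\in M$ with respect to $\alpha$ is $Q_\alpha(p)=\int_{\gamma_w}f_\alpha$, where $\gamma_w(t)=\Phi_{\Gamma^2}^{e^{2\pi i t}}(w)$, $t\in[0,1]$, for any $w\in\pi_{\Gamma_J^2}^{-1}(p)$ (the value is independent of $w$ in the fiber). At a fixed point $p$ of $\Phi$, the local Maslov index is $k_p=Q_\alpha(p)$. *)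

(* Defs.v *)
From HB Require Import structures.
From mathcomp Require Import all_boot all_order all_algebra.
From mathcomp Require Import spectral complex.
From mathcomp Require Import all_classical all_reals all_analysis.
Import Order.TTheory GRing.Theory Num.Theory.
Import numFieldNormedType.Exports.

Set Implicit Arguments.
Unset Strict Implicit.
Unset Printing Implicit Defensive.

Local Open Scope classical_set_scope.
Local Open Scope ring_scope.

Fixpoint Ck (R : realType) (V W : normedModType R) (k : nat)
    (f : V -> W) (U : set V) : Prop :=
  if k is k'.+1 then
    (forall x, U x -> differentiable f x) /\
    (forall v, Ck k' (fun x => 'D_v f x) U)
  else forall x, U x -> {for x, continuous f}.

(* Only meaningful for U open. *)
Definition smooth_on (R : realType) (V W : normedModType R)
    (f : V -> W) (U : set V) : Prop := forall k, Ck k f U.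

(* [cinv] is the inverse of [cfun] between [cdom] and its image; both functions
   carry arbitrary values elsewhere. *)
Record chart (R : realType) (X : Type) (V : normedModType R) := Chart {
  cdom : set X;
  cfun : X -> V;
  cinv : V -> X }.

HB.instance Definition _ (R : realType) (X : Type) (V : normedModType R) :=
  gen_eqMixin (chart X V).
HB.instance Definition _ (R : realType) (X : Type) (V : normedModType R) :=
  gen_choiceMixin (chart X V).
HB.instance Definition _ (R : realType) (X : pointedType)
    (V : normedModType R) :=
  isPointed.Build (chart X V) (Chart set0 (fun=> 0) (fun=> point)).

Definition cimg (R : realType) (X : Type) (V : normedModType R)
  (c : chart X V) : set V := cfun c @` cdom c.

(* M is a (Hausdorff, second countable) smooth manifold modelled on V, with
   the smooth structure generated by the atlas A. *)
Record smooth_manifold (R : realType) (V : normedModType R)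
    (M : topologicalType) (A : set (chart M V)) : Prop := SmoothManifold {
  manifold_hausdorff : hausdorff_space M;
  manifold_countable : @second_countable M;
  manifold_cover : forall q : M, exists2 c, A c & cdom c q;
  manifold_dom : forall c, A c -> open (cdom c);
  manifold_img : forall c, A c -> open (cimg c);
  manifold_inv : forall c q, A c -> cdom c q -> cinv c (cfun c q) = q;
  manifold_cfun : forall c q, A c -> cdom c q -> {for q, continuous (cfun c)};
  manifold_cinv : forall c x, A c -> cimg c x -> {for x, continuous (cinv c)};
  manifold_transition : forall c c', A c -> A c' ->
    smooth_on (cfun c' \o cinv c) (cfun c @` (cdom c `&` cdom c')) }.

(* A preferred chart at each point. The tangent space at q is represented by
   the model space V: the vector v : V at q stands for the tangent vector whose
   coordinates in the chart [chart_at A q] are v. *)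
Definition chart_at (R : realType) (V : normedModType R) (X : pointedType)
    (A : set (chart X V)) (q : X) : chart X V :=
  get [set c | A c /\ cdom c q].

(* Coordinates in the chart c of the tangent vector v at q. *)
Definition to_chart (R : realType) (V : normedModType R) (X : pointedType)
    (A : set (chart X V)) (c : chart X V) (q : X) (v : V) : V :=
  'D_v (cfun c \o cinv (chart_at A q)) (cfun (chart_at A q) q).

(* The tangent vector at [cinv c x] whose coordinates in the chart c are v. *)
Definition of_chart (R : realType) (V : normedModType R) (X : pointedType)
    (A : set (chart X V)) (c : chart X V) (x v : V) : V :=
  'D_v (cfun (chart_at A (cinv c x)) \o cinv c) x.

(* The differential of F at q applied to the tangent vector v. *)
Definition tangent_map (R : realType) (V : normedModType R) (X : pointedType)
    (A : set (chart X V)) (F : X -> X) (q : X) (v : V) : V :=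
  'D_v (cfun (chart_at A (F q)) \o F \o cinv (chart_at A q))
       (cfun (chart_at A q) q).

Definition velocity (R : realType) (V : normedModType R) (X : pointedType)
    (A : set (chart X V)) (g : R -> X) (t : R) : V :=
  derive1 (cfun (chart_at A (g t)) \o g) t.

Definition smooth_form1 (R : realType) (V : normedModType R) (X : pointedType)
    (A : set (chart X V)) (f : X -> V -> R) : Prop :=
  forall c v, A c ->
    smooth_on (fun x => f (cinv c x) (of_chart A c x v) : R^o) (cimg c).

Definition circle (R : realType) : set R[i] := [set z | `|z| = 1].

Definition expi (R : realType) (t : R) : R[i] :=
  Complex (cos (2 * pi * t)) (sin (2 * pi * t)).

(* k is the degree of the continuous map zeta : S^1 -> S^1, read off a
   continuous lift tau : R -> R of t |-> zeta (expi t). *)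
Definition circle_degree (R : realType) (zeta : R[i] -> R[i]) (k : int) : Prop :=
  exists tau : R -> R,
    [/\ continuous tau,
        forall t, zeta (expi t) = expi (tau t) &
        tau 1 - tau 0 = k%:~R].

(* Components in the chart c of the 2-tensor om. *)
Definition local2 (R : realType) (V : normedModType R) (X : pointedType)
    (A : set (chart X V)) (om : X -> V -> V -> R) (c : chart X V)
    (u v x : V) : R :=
  om (cinv c x) (of_chart A c x u) (of_chart A c x v).

(* The closedness condition is d om = 0 evaluated on constant coordinate
   vector fields. *)
Record symplectic_form (R : realType) (V : normedModType R) (X : pointedType)
    (A : set (chart X V)) (om : X -> V -> V -> R) : Prop := SymplecticForm {
  symplectic_linear : forall q a u u' v,
    om q (a *: u + u') v = a * om q u v + om q u' v;
  symplectic_antisym : forall q u v, om q v u = - om q u v;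
  symplectic_smooth : forall c u v, A c ->
    smooth_on (local2 A om c u v : V -> R^o) (cimg c);
  symplectic_closed : forall c u v w x, A c -> cimg c x ->
    'D_u (local2 A om c v w : V -> R^o) x +
    'D_v (local2 A om c w u : V -> R^o) x +
    'D_w (local2 A om c u v : V -> R^o) x = 0;
  symplectic_nondegenerate : forall q u, (forall v, om q u v = 0) -> u = 0 }.

Definition gJ (R : realType) (m : nat) (X : Type)
    (om : X -> 'cV[R]_m -> 'cV[R]_m -> R) (J : X -> 'M[R]_m) (q : X)
    (u v : 'cV[R]_m) : R := om q (J q *m u) v.

(* Smoothness of g_J follows from that of om and J. *)
Record compatible_acs (R : realType) (m : nat) (X : pointedType)
    (A : set (chart X 'cV[R]_m)) (om : X -> 'cV[R]_m -> 'cV[R]_m -> R)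
    (J : X -> 'M[R]_m) : Prop := CompatibleACS {
  acs_square : forall q, J q *m J q = - 1%:M;
  acs_smooth : forall c u, A c ->
    smooth_on (fun x => to_chart A c (cinv c x)
                          (J (cinv c x) *m of_chart A c x u)) (cimg c);
  acs_sym : forall q u v, gJ om J q u v = gJ om J q v u;
  acs_pos : forall q u, u != 0 -> 0 < gJ om J q u u }.

(* Joint smoothness S^1 * M -> M is tested after composition with the local
   diffeomorphism [expi : R -> S^1]. *)
Record symplectic_action (R : realType) (V : normedModType R)
    (M : ptopologicalType) (A : set (chart M V)) (om : M -> V -> V -> R)
    (Phi : R[i] -> M -> M) : Prop := SymplecticAction {
  action1 : forall q, Phi 1 q = q;
  actionM : forall z z' q, circle z -> circle z' ->
    Phi (z * z') q = Phi z (Phi z' q);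
  action_continuous : continuous (fun tq : R * M => Phi (expi tq.1) tq.2);
  action_smooth : forall c c', A c -> A c' ->
    smooth_on (fun tx : (R^o * V)%type =>
                 cfun c' (Phi (expi (tx.1 : R)) (cinv c tx.2)))
      [set tx | cimg c tx.2 /\ cdom c' (Phi (expi (tx.1 : R)) (cinv c tx.2))];
  action_symplectic : forall z q u v, circle z ->
    om (Phi z q) (tangent_map A (Phi z) q u) (tangent_map A (Phi z) q v)
    = om q u v }.

Definition invariant_acs (R : realType) (m : nat) (X : pointedType)
    (A : set (chart X 'cV[R]_m)) (Phi : R[i] -> X -> X)
    (J : X -> 'M[R]_m) : Prop :=
  forall z q u, circle z ->
    tangent_map A (Phi z) q (J q *m u) = J (Phi z q) *m tangent_map A (Phi z) q u.

(* The real matrix [A, -B; B, A] of A + iB. *)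
Definition realify (R : realType) (n : nat) (C : 'M[R[i]]_n) : 'M[R]_(n + n) :=
  let A := \matrix_(i, j) complex.Re (C i j) in
  let B := \matrix_(i, j) complex.Im (C i j) in
  block_mx A (- B) B A.

(* The columns of F are the frame (u_1, .., u_n, v_1, .., v_n) of the tangent
   space at q; C in U(n) acts by F |-> F *m realify C. *)
Record unitary_frame (R : realType) (n : nat) (X : Type)
    (om : X -> 'cV[R]_(n + n) -> 'cV[R]_(n + n) -> R)
    (J : X -> 'M[R]_(n + n)) (q : X) (F : 'M[R]_(n + n)) : Prop :=
  UnitaryFrame {
  frame_basis : F \in unitmx;
  frame_v : forall i : 'I_n,
    col (rshift n i) F = - (J q *m col (lshift n i) F);
  frame_uu : forall i j : 'I_n,
    gJ om J q (col (lshift n i) F) (col (lshift n j) F) = (i == j)%:R;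
  frame_uv : forall i j : 'I_n,
    gJ om J q (col (lshift n i) F) (col (rshift n j) F) = 0 }.

(* s is smooth on the open set U as a tuple of vector fields. *)
Definition smooth_local_frame (R : realType) (m : nat) (X : pointedType)
    (A : set (chart X 'cV[R]_m)) (U : set X) (s : X -> 'M[R]_m) : Prop :=
  forall c j, A c ->
    smooth_on (fun x => to_chart A c (cinv c x) (col j (s (cinv c x))))
              (cfun c @` (U `&` cdom c)).

(* An isomorphism Fr^u_J -> Fr^u_J' of principal U(n)-bundles over M, where
   Psi q maps frames at q to frames at q. Smoothness is expressed on smooth
   local sections; bijectivity and smoothness of the inverse are automatic from
   equivariance over the identity. *)
Record frame_bundle_iso (R : realType) (n : nat) (M : ptopologicalType)
    (A : set (chart M 'cV[R]_(n + n)))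
    (om : M -> 'cV[R]_(n + n) -> 'cV[R]_(n + n) -> R)
    (J J' : M -> 'M[R]_(n + n))
    (Psi : M -> 'M[R]_(n + n) -> 'M[R]_(n + n)) : Prop := FrameBundleIso {
  frame_iso_frame : forall q F,
    unitary_frame om J q F -> unitary_frame om J' q (Psi q F);
  frame_iso_equiv : forall q F (C : 'M[R[i]]_n),
    unitary_frame om J q F -> C \is unitarymx ->
    Psi q (F *m realify C) = Psi q F *m realify C;
  frame_iso_smooth : forall (U : set M) (s : M -> 'M[R]_(n + n)), open U ->
    (forall q, U q -> unitary_frame om J q (s q)) ->
    smooth_local_frame A U s ->
    smooth_local_frame A U (fun q => Psi q (s q)) }.

Definition framed (R : realType) (n : nat) (X : Type) : Type :=
  (X * 'M[R]_(n + n))%type.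

(* Points of Gamma_J^2 are EU(n)-orbits of framed points. *)
Definition EU (R : realType) (n : nat) : set 'M[R[i]]_n :=
  [set C | C \is unitarymx /\ (\det C = 1 \/ \det C = -1)].
Arguments EU {R n}.

Definition frame_class (R : realType) (n : nat) (X : Type) (q : X)
    (F : 'M[R]_(n + n)) : set (framed R n X) :=
  [set (q, F *m realify C) | C in EU].

Definition gamma_fiber (R : realType) (n : nat) (X : Type)
    (om : X -> 'cV[R]_(n + n) -> 'cV[R]_(n + n) -> R)
    (J : X -> 'M[R]_(n + n)) (q : X) : set (set (framed R n X)) :=
  [set frame_class q F | F in unitary_frame om J q].

Definition gamma (R : realType) (n : nat) (X : Type)
    (om : X -> 'cV[R]_(n + n) -> 'cV[R]_(n + n) -> R)
    (J : X -> 'M[R]_(n + n)) : set (set (framed R n X)) :=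
  \bigcup_q gamma_fiber om J q.

(* The inherent action [f] . z = [f . C], where (det C)^2 = z. *)
Definition gamma_act (R : realType) (n : nat) (X : Type)
    (w : set (framed R n X)) (z : R[i]) : set (framed R n X) :=
  [set f | exists (g : framed R n X) (C : 'M[R[i]]_n),
     [/\ w g, C \is unitarymx, (\det C) ^+ 2 = z & f = (g.1, g.2 *m realify C)]].

Definition gamma_model (R : realType) (n : nat) : normedModType R :=
  ('cV[R]_(n + n) * R^o)%type.

(* The quotient smooth structure: a chart c of M, an open U inside its domain,
   a smooth local unitary frame s on U and a real a give the chart
   [s q] . e^{2 pi i theta} |-> (c q, theta), for q in U, a < theta < a + 1. *)
Definition gamma_atlas (R : realType) (n : nat) (M : ptopologicalType)
    (A : set (chart M 'cV[R]_(n + n)))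
    (om : M -> 'cV[R]_(n + n) -> 'cV[R]_(n + n) -> R)
    (J : M -> 'M[R]_(n + n)) :
    set (chart (set (framed R n M)) (gamma_model R n)) :=
  [set d | exists c U s (a : R),
     let pt q theta := gamma_act (frame_class q (s q)) (expi theta) in
     let I := [set theta : R | a < theta < a + 1] in
     [/\ A c, open U /\ U `<=` cdom c,
         (forall q, U q -> unitary_frame om J q (s q)),
         smooth_local_frame A U s &
         [/\ cdom d = [set w | exists q theta, [/\ U q, I theta & w = pt q theta]],
             (forall q theta, U q -> I theta ->
                cfun d (pt q theta) = (cfun c q, theta)) &
             (forall q theta, U q -> I theta ->
                cinv d (cfun c q, theta) = pt q theta)]]].

(* The vector field generating t |-> w . e^{2 pi i t}. *)
Definition d_theta (R : realType) (n : nat) (M : ptopologicalType)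
    (A : set (chart M 'cV[R]_(n + n)))
    (om : M -> 'cV[R]_(n + n) -> 'cV[R]_(n + n) -> R)
    (J : M -> 'M[R]_(n + n)) (w : set (framed R n M)) : gamma_model R n :=
  velocity (gamma_atlas A om J) (fun t : R => gamma_act w (expi t)) 0.

(* f is the real form f_alpha of the connection alpha = f_alpha d/dtheta. *)
Record connection_form (R : realType) (n : nat) (M : ptopologicalType)
    (A : set (chart M 'cV[R]_(n + n)))
    (om : M -> 'cV[R]_(n + n) -> 'cV[R]_(n + n) -> R)
    (J : M -> 'M[R]_(n + n))
    (f : set (framed R n M) -> gamma_model R n -> R) : Prop := ConnectionForm {
  connection_linear : forall w a u v, gamma om J w ->
    f w (a *: u + v) = a * f w u + f w v;
  connection_smooth : smooth_form1 (gamma_atlas A om J) f;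
  connection_invariant : forall w z v, gamma om J w -> circle z ->
    f (gamma_act w z)
      (tangent_map (gamma_atlas A om J) (fun w' => gamma_act w' z) w v) = f w v;
  connection_d_theta : forall w, gamma om J w -> f w (d_theta A om J w) = 1 }.

(* The action on Gamma_J^2 lifting Phi: the action
   [f] |-> [Phi^z_* f] on Gamma_J0^2, for J0 invariant, transported through the
   isomorphism Psi : Fr^u_J0 -> Fr^u_J. *)
Definition push_frame (R : realType) (n : nat) (X : pointedType)
    (A : set (chart X 'cV[R]_(n + n))) (phi : X -> X) (f : framed R n X) :
    framed R n X :=
  (phi f.1, \matrix_(i, j) (tangent_map A phi f.1 (col j f.2) i 0)).

Definition lifted_action (R : realType) (n : nat) (X : pointedType)
    (A : set (chart X 'cV[R]_(n + n)))
    (om : X -> 'cV[R]_(n + n) -> 'cV[R]_(n + n) -> R)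
    (J0 : X -> 'M[R]_(n + n)) (Psi : X -> 'M[R]_(n + n) -> 'M[R]_(n + n))
    (Phi : R[i] -> X -> X) (z : R[i]) (w : set (framed R n X)) :
    set (framed R n X) :=
  let Psi' (f : framed R n X) : framed R n X := (f.1, Psi f.1 f.2) in
  [set Psi' (push_frame A (Phi z) f) |
     f in [set f | unitary_frame om J0 f.1 f.2 /\ w (Psi' f)]].

(* The integral of f_alpha along t |-> lift e^{2 pi i t} w, t in [0, 1]. *)
Definition orbit_integral (R : realType) (n : nat) (M : ptopologicalType)
    (A : set (chart M 'cV[R]_(n + n)))
    (om : M -> 'cV[R]_(n + n) -> 'cV[R]_(n + n) -> R)
    (J : M -> 'M[R]_(n + n))
    (lift : R[i] -> set (framed R n M) -> set (framed R n M))
    (f : set (framed R n M) -> gamma_model R n -> R)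
    (w : set (framed R n M)) : R :=
  let g (t : R) := lift (expi t) w in
  \int[lebesgue_measure]_(t in `[0, 1])
     f (g t) (velocity (gamma_atlas A om J) g t).

(* Q_alpha(p), with w some point of the fiber over p. *)
Definition maslov_data (R : realType) (n : nat) (M : ptopologicalType)
    (A : set (chart M 'cV[R]_(n + n)))
    (om : M -> 'cV[R]_(n + n) -> 'cV[R]_(n + n) -> R)
    (J : M -> 'M[R]_(n + n))
    (lift : R[i] -> set (framed R n M) -> set (framed R n M))
    (f : set (framed R n M) -> gamma_model R n -> R) (p : M) : R :=
  orbit_integral A om J lift f (get (gamma_fiber om J p)).

(* Main.v *)
(* At the fixed point [p] the isotropy representation [t |-> d Phi^{e(t)}_p],
   with [e(t) = e^{2 pi i t}], commutes with [J0] and preserves the metric. In a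
   unitary frame [F0] it therefore reads [L_t F0 = F0 C_t] for a one-parameter
   group [C] of unitary matrices, differentiable because the action is smooth.
   By U(n)-equivariance of [Psi], the lifted action moves any point [w] of the
   fiber to [w . (det C_t)^2]. Now [(det C_t)^2] is a differentiable character of
   R with values in the circle, of period 1, so it equals [e(k t)] for an integer
   [k]. The orbit of [w] thus runs along the fiber with velocity [k d/dtheta], on
   which a connection form takes the value [k]. *)
Require Import Defs.
From mathcomp Require Import all_boot all_order all_algebra.
From mathcomp Require Import spectral complex.
From mathcomp Require Import all_classical all_reals all_analysis.
From mathcomp Require Import ring lra.
Import Order.TTheory GRing.Theory Num.Theory.
Import numFieldNormedType.Exports.
Set Implicit Arguments.
Unset Strict Implicit.
Unset Printing Implicit Defensive.

Local Open Scope classical_set_scope.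
Local Open Scope ring_scope.

(** * The unit circle, the exponential [expi] and characters of the circle *)

Lemma circleP (R : realType) (z : R[i]) :
  circle z <-> complex.Re z ^+ 2 + complex.Im z ^+ 2 = 1.
Proof.
rewrite /circle /= normc_def; split => [[]|->]; last by rewrite sqrtr1.
move=> h; rewrite -[LHS]sqr_sqrtr ?h ?expr1n //.
by rewrite addr_ge0 // sqr_ge0.
Qed.

Lemma expi0 (R : realType) : expi (0 : R) = 1.
Proof. by rewrite /expi mulr0 cos0 sin0. Qed.

Lemma expiD (R : realType) (s t : R) : expi (s + t) = expi s * expi t.
Proof.
rewrite /expi mulrDr cosD sinD; apply/eqP; rewrite eq_complex /=.
by apply/andP; split; apply/eqP; ring.
Qed.

Lemma circle_expi (R : realType) (t : R) : circle (expi t).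
Proof. by apply/circleP; rewrite /= cos2Dsin2. Qed.

Lemma expi1 (R : realType) : expi (1 : R) = 1.
Proof. by rewrite /expi mulr1 mulr_natl cos2pi sin2pi. Qed.

(** The arccosine of the real part gives the angle on the upper half circle; its opposite serves on
    the lower half. *)
Lemma circle_expiE (R : realType) (z : R[i]) : circle z -> exists t, z = expi t.
Proof.
case: z => x y /circleP /= xy1.
have x1 : -1 <= x <= 1.
  rewrite -ler_norml -(@ler_pXn2r _ 2) ?nnegrE // expr1n real_normK ?num_real //.
  by rewrite -xy1 lerDl sqr_ge0.
have pi0 : 2 * pi != 0 :> R by rewrite mulf_neq0 ?pnatr_eq0 // gt_eqF ?pi_gt0.
have sqE : Num.sqrt (1 - x ^+ 2) = `|y|.
  by rewrite -xy1 addrAC subrr add0r sqrtr_sqr.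
have ca : cos (acos x) = x by rewrite acosK // in_itv.
have [y0|y0] := lerP 0 y.
  exists (acos x / (2 * pi)).
  by rewrite /expi mulrC divfK // ca sin_acos // sqE ger0_norm.
exists (- acos x / (2 * pi)).
by rewrite /expi mulrC divfK // cosN sinN ca sin_acos // sqE ltr0_norm // opprK.
Qed.

Lemma expi_int (R : realType) (m : int) : expi (m%:~R : R) = 1.
Proof.
have nat1 (j : nat) : expi (j%:R : R) = 1.
  by elim: j => [|j IHj]; rewrite ?expi0 // -natr1 expiD IHj expi1 mulr1.
case: m => j; first exact: nat1.
by rewrite NegzE mulrNz -[LHS]mulr1 -(nat1 j.+1) -expiD addNr expi0.
Qed.

(** Removing the floor leaves r in [0, 1[ with cos(2 pi r) = 1. The double angle formula turns this
    into sin(pi r) = 0, which is impossible for 0 < r < 1 since the sine is positive on ]0, pi[. *)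
Lemma expi_eq1 (R : realType) (t : R) :
  expi t = 1 -> exists k : int, t = k%:~R.
Proof.
move=> t1; exists (Num.floor t); apply/eqP; rewrite -subr_eq0.
set r := t - _.
have r1 : expi r = 1.
  by rewrite /r expiD -[RHS]t1 -mulrNz expi_int mulr1.
have [r_ge0 r_lt1] : 0 <= r /\ r < 1.
  rewrite /r subr_ge0 ltrBlDl; split; first exact: floor_le.
  by rewrite -[X in _ < _ + X]/(1%:~R) -intrD; exact: floorD1_gt.
have [//|r_neq0] := eqVneq r 0.
have : 0 < sin (pi * r).
  have r_gt0 : 0 < r by rewrite lt_def r_neq0.
  by apply: sin_gt0_pi; rewrite mulr_gt0 ?gtr_pMr ?pi_gt0.
have := cos_mulr2n (pi * r); rewrite cos2sin2.
move: r1 => /(congr1 (@complex.Re R)) /=.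
rewrite -mulrA mulr_natl => -> E.
have /eqP : sin (pi * r) ^+ 2 = 0 by lra.
by rewrite sqrf_eq0 => /eqP ->; rewrite ltxx.
Qed.

(* A differentiable one-parameter group in C has derivative [z' = z'(0) z]; on
   the circle [z'(0)] is purely imaginary, hence [z] agrees with an exponential. *)
Lemma circle_characterE (R : realType) (z : R -> R[i]) :
  (forall t, circle (z t)) -> z 1 = 1 ->
  (forall s t, z (s + t) = z s * z t) ->
  derivable (fun t => complex.Re (z t)) 0 1 ->
  derivable (fun t => complex.Im (z t)) 0 1 ->
  exists k : int, forall t, z t = expi (k%:~R * t).
Proof.
move=> zc z1 zD dx0 dy0.
pose x t := complex.Re (z t); pose y t := complex.Im (z t).
have zE t : z t = Complex (x t) (y t) by rewrite /x /y; case: (z t).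
have xD s t : x (s + t) = x s * x t - y s * y t.
  by rewrite /x /y zD; case: (z s) => a b; case: (z t).
have yD s t : y (s + t) = x s * y t + y s * x t.
  by rewrite /x /y zD; case: (z s) => a b; case: (z t).
have xy t : x t ^+ 2 + y t ^+ 2 = 1 by apply/circleP.
have z0 : z 0 = 1.
  have : z 1 = z 1 * z 0 by rewrite -zD addr0.
  by rewrite z1 mul1r.
have x0 : x 0 = 1 by rewrite /x z0.
have y0 : y 0 = 0 by rewrite /y z0.
pose a := 'D_1 x 0; pose b := 'D_1 y 0.
have Dx0 : is_derive (0 : R) 1 x a := DeriveDef dx0 erefl.
have Dy0 : is_derive (0 : R) 1 y b := DeriveDef dy0 erefl.
(* Differentiating x^2 + y^2 = 1 at 0, where (x, y) = (1, 0), gives 2 a = 0. *)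
have a0 : a = 0.
  have D1 : is_derive (0 : R) 1 (x ^+ 2 + y ^+ 2) (2 * a).
    by apply: is_derive_eq; rewrite ?x0 ?y0 /GRing.scale /=; ring.
  have E : x ^+ 2 + y ^+ 2 = cst 1 by apply/funext => t; rewrite /= !fctE; exact: xy.
  have /@derive_val := D1; rewrite E derive_cst => /esym/eqP.
  by rewrite mulf_eq0 pnatr_eq0 /= => /eqP.
have shiftE (f : R -> R) (t : R) : f = (fun u => f (t + (u - t))).
  by apply/funext => u; rewrite addrCA subrr addr0.
have Dsh (f : R -> R) df (t : R) : is_derive (0 : R) 1 f df ->
    is_derive t 1 (fun u => f (u - t)) df.
  move=> Df.
  have D0 : is_derive (t - t) 1 f df by rewrite subrr.
  have DB : is_derive t 1 (fun u : R => u - t) (1 : R).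
    by apply: is_derive_eq; rewrite ?subr0.
  have := @is_derive1_comp _ f (fun u : R => u - t) t _ _ D0 DB.
  by rewrite mulr1.
(* Expanding around t by the group law carries the derivative at 0 to t: z' = i b z. *)
have Dx (t : R) : is_derive t 1 x (- (b * y t)).
  rewrite (shiftE x t); under eq_fun do rewrite xD.
  have h1 := Dsh _ _ t Dx0; have h2 := Dsh _ _ t Dy0.
  apply: is_derive_eq; rewrite a0 /GRing.scale /=; ring.
have Dy (t : R) : is_derive t 1 y (b * x t).
  rewrite (shiftE y t); under eq_fun do rewrite yD.
  have h1 := Dsh _ _ t Dx0; have h2 := Dsh _ _ t Dy0.
  apply: is_derive_eq; rewrite a0 /GRing.scale /=; ring.
(* The exponential with the same initial velocity. [P] and [Q] below are the real and imaginary
   parts of z (c - i s) = 1, a product whose derivative vanishes. *)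
pose c t := cos (b * t); pose s t := sin (b * t).
have Dc (t : R) : is_derive t 1 c (- (b * s t)).
  by rewrite /c; apply: is_derive_eq; rewrite /s /GRing.scale /=; ring.
have Ds (t : R) : is_derive t 1 s (b * c t).
  by rewrite /s; apply: is_derive_eq; rewrite /c /GRing.scale /=; ring.
have cs t : c t ^+ 2 + s t ^+ 2 = 1 by exact: cos2Dsin2.
have c0 : c 0 = 1 by rewrite /c mulr0 cos0.
have s0 : s 0 = 0 by rewrite /s mulr0 sin0.
have P (t : R) : x t * c t + y t * s t = 1.
  have D (u : R) : is_derive u 1 (x * c + y * s) 0.
    by apply: is_derive_eq; rewrite /GRing.scale /=; ring.
  have := is_derive_0_is_cst t 0 D.
  by rewrite !fctE x0 y0 c0 mul0r addr0 mulr1.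
have Q (t : R) : y t * c t - x t * s t = 0.
  have D (u : R) : is_derive u 1 (y * c - x * s) 0.
    by apply: is_derive_eq; rewrite /GRing.scale /=; ring.
  have := is_derive_0_is_cst t 0 D.
  by rewrite !fctE x0 y0 c0 s0 mul0r mulr0 subrr.
have xE t : x t = c t.
  transitivity ((x t * c t + y t * s t) * c t - (y t * c t - x t * s t) * s t).
    transitivity (x t * (c t ^+ 2 + s t ^+ 2)); last by ring.
    by rewrite cs mulr1.
  by rewrite P Q mul1r mul0r subr0.
have yE t : y t = s t.
  transitivity ((x t * c t + y t * s t) * s t + (y t * c t - x t * s t) * c t).
    transitivity (y t * (c t ^+ 2 + s t ^+ 2)); last by ring.
    by rewrite cs mulr1.
  by rewrite P Q mul1r mul0r addr0.
have pi0 : 2 * pi != 0 :> R by rewrite mulf_neq0 ?pnatr_eq0 // gt_eqF ?pi_gt0.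
have zexp t : z t = expi (b / (2 * pi) * t).
  by rewrite zE xE yE /c /s /expi mulrA [2 * pi * _]mulrC divfK.
have [k bE] : exists k : int, b / (2 * pi) = k%:~R.
  by apply: expi_eq1; rewrite -[X in expi X]mulr1 -zexp z1.
by exists k => t; rewrite zexp bE.
Qed.

(** * Complex matrices as real block matrices *)

(** The matrix of J in a frame with v_i = - J u_i, where J u_i = - v_i and J v_i = u_i. *)
Definition std_J (R : realType) (n : nat) : 'M[R]_(n + n) :=
  block_mx 0 1%:M (- 1%:M) 0.

Definition complexify (R : realType) (n : nat) (K : 'M[R]_(n + n)) : 'M[R[i]]_n :=
  \matrix_(i, j) Complex (K (lshift n i) (lshift n j)) (K (rshift n i) (lshift n j)).

Lemma complexify_block (R : realType) (n : nat) (a b c d : 'M[R]_n) :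
  complexify (block_mx a b c d) = \matrix_(i, j) Complex (a i j) (c i j).
Proof. by apply/matrixP => i j; rewrite [RHS]mxE [LHS]mxE block_mxEul block_mxEdl. Qed.

(** Commuting with [std_J] forces the block form [a, -c; c, a], so the first block column, the only
    one that [complexify] reads, determines the matrix. *)
Lemma realify_complexify (R : realType) (n : nat) (K : 'M[R]_(n + n)) :
  K *m std_J R n = std_J R n *m K -> realify (complexify K) = K.
Proof.
rewrite -[K]submxK; move: (ulsubmx K) (ursubmx K) (dlsubmx K) (drsubmx K) => a b c d.
rewrite /std_J !mulmx_block !(mulmx0, mul0mx, mulmx1, mul1mx, addr0, add0r).
rewrite !mulmxN !mulNmx !mulmx1 !mul1mx => /eq_block_mx [cE <- _ _].
have {cE}-> : b = - c by rewrite -cE opprK.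
by rewrite complexify_block /realify; congr block_mx; apply/matrixP => i j; rewrite !mxE.
Qed.

Lemma realify_inj (R : realType) (n : nat) : injective (@realify R n).
Proof.
move=> C D /eq_block_mx [/matrixP a _ /matrixP b _].
apply/matrixP => i j; move: (a i j) (b i j); rewrite !mxE.
by case: (C i j) (D i j) => [? ?] [? ?] /= -> ->.
Qed.

Lemma realifyM (R : realType) (n : nat) (C D : 'M[R[i]]_n) :
  realify (C *m D) = realify C *m realify D.
Proof.
have ReM (x y : R[i]) : complex.Re (x * y)
    = complex.Re x * complex.Re y - complex.Im x * complex.Im y by case: x y => ? ? [].
have ImM (x y : R[i]) : complex.Im (x * y)
    = complex.Im x * complex.Re y + complex.Re x * complex.Im y.
  by case: x y => a b [c d] /=; rewrite addrC.
have ReE i j : complex.Re (\sum_k C i k * D k j) =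
    \sum_k (complex.Re (C i k) * complex.Re (D k j)
      - complex.Im (C i k) * complex.Im (D k j)).
  rewrite (big_morph (@complex.Re R) (id1 := 0) (op1 := +%R)) //; last by case=> ? ? [].
  by apply: eq_bigr => k _; rewrite ReM.
have ImE i j : complex.Im (\sum_k C i k * D k j) =
    \sum_k (complex.Im (C i k) * complex.Re (D k j)
      + complex.Re (C i k) * complex.Im (D k j)).
  rewrite (big_morph (@complex.Im R) (id1 := 0) (op1 := +%R)) //; last by case=> ? ? [].
  by apply: eq_bigr => k _; rewrite ImM.
rewrite /realify mulmx_block; congr block_mx; apply/matrixP => i j; rewrite !mxE.
- rewrite ReE -big_split /=; apply: eq_bigr => k _; by rewrite !mxE mulNr.
- rewrite ImE -big_split -sumrN /=; apply: eq_bigr => k _; rewrite !mxE.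
  by rewrite mulrN mulNr opprD addrC.
- rewrite ImE -big_split /=; apply: eq_bigr => k _; by rewrite !mxE.
- rewrite ReE -big_split /=; apply: eq_bigr => k _; rewrite !mxE.
  by rewrite mulrN addrC.
Qed.

Lemma realify1 (R : realType) (n : nat) : realify (1%:M : 'M[R[i]]_n) = 1%:M.
Proof.
rewrite /realify -[RHS]/(1%:M) (scalar_mx_block n n 1).
congr block_mx; apply/matrixP => i j; rewrite !mxE; case: (i == j) => //=; exact: oppr0.
Qed.

Lemma realify_tr (R : realType) (n : nat) (C : 'M[R[i]]_n) :
  realify (C^T ^ Num.conj)%sesqui = (realify C)^T.
Proof.
rewrite /realify tr_block_mx; congr block_mx; apply/matrixP => i j; rewrite !mxE;
  by case: (C j i) => a b //=; rewrite ?opprK.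
Qed.

Lemma realify_std_J (R : realType) (n : nat) (C : 'M[R[i]]_n) :
  realify C *m std_J R n = std_J R n *m realify C.
Proof.
rewrite /realify /std_J !mulmx_block !(mulmx0, mul0mx, mulmx1, mul1mx, addr0, add0r).
by rewrite !mulmxN !mulNmx !mulmx1 !mul1mx opprK.
Qed.

(** [realify] is an injective multiplicative map taking the conjugate transpose to the transpose, so
    unitary means orthogonal after realification. *)
Lemma realify_unitary (R : realType) (n : nat) (C : 'M[R[i]]_n) :
  (C \is unitarymx) = ((realify C)^T *m realify C == 1%:M).
Proof.
rewrite -realify_tr -realifyM -realify1 (inj_eq (@realify_inj R n)).
apply/unitarymxP/eqP => h; first exact: mulmx1C.
exact: mulmx1C h.
Qed.

(* The matrix form of [unitary_frame], for the complex structure [J] and the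
   Gram matrix [G] of the metric. *)
Definition unitary_basis (R : realType) (n : nat) (J G F : 'M[R]_(n + n)) : Prop :=
  J *m F = F *m std_J R n /\ F^T *m G *m F = 1%:M.

(** * Linear algebra of unitary bases *)

Section UnitaryBasis.
Variables (R : realType) (n : nat) (J G : 'M[R]_(n + n)).
Implicit Types F : 'M[R]_(n + n).

Lemma unitary_basis_unit F : unitary_basis J G F -> F \in unitmx.
Proof. by case=> _ /mulmx1_unit []. Qed.

Lemma unitary_basisM F (C : 'M[R[i]]_n) :
  unitary_basis J G F -> C \is unitarymx -> unitary_basis J G (F *m realify C).
Proof.
move=> [JF GF]; rewrite realify_unitary => /eqP CC; split.
  by rewrite mulmxA JF -!mulmxA realify_std_J.
rewrite trmx_mul -!mulmxA (mulmxA G) (mulmxA F^T) (mulmxA F^T) GF mul1mx.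
exact: CC.
Qed.

(** The transition matrix intertwines [std_J] with itself, hence is complex; both Gram matrices
    being 1, it is also orthogonal. *)
Lemma unitary_basis_trans F F' : unitary_basis J G F -> unitary_basis J G F' ->
  let C := complexify (invmx F *m F') in
  C \is unitarymx /\ F' = F *m realify C.
Proof.
move=> uF [JF' GF'] C.
have Fu := unitary_basis_unit uF; case: uF => JF GF.
have KE : realify C = invmx F *m F'.
  apply: realify_complexify.
  rewrite -mulmxA -JF' -[X in J *m X](mulKVmx Fu) (mulmxA J) JF.
  by rewrite !mulmxA mulVmx // mul1mx.
have F'E : F' = F *m realify C by rewrite KE mulKVmx.
split=> //; rewrite realify_unitary.
move: GF'; rewrite F'E trmx_mul -!mulmxA (mulmxA G) (mulmxA F^T) (mulmxA F^T) GF mul1mx.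
by move=> ->.
Qed.

Hypothesis JJ : J *m J = - 1%:M.
Hypothesis Gsym : G^T = G.
Hypothesis JGJ : J^T *m G *m J = G.
Hypothesis Gpos : forall u : 'cV[R]_(n + n), u != 0 -> 0 < (u^T *m G *m u) 0 0.

(** Only the first half of the basis needs checking: transposition yields the other mixed block, and
    the block of the second half follows because J is an isometry. *)
Lemma unitary_basis_row (U : 'M[R]_(n + n, n)) :
  U^T *m G *m U = 1%:M -> U^T *m (G *m J) *m U = 0 ->
  unitary_basis J G (row_mx U (- (J *m U))).
Proof.
move=> UU UJU.
split.
  rewrite /std_J mul_mx_row mul_row_block !(mulmx0, mulmx1, mulmxN, addr0, add0r).
  by rewrite mulmxA JJ mulNmx mul1mx !opprK.
have UJT : U^T *m J^T *m G *m U = 0.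
  by move: (congr1 trmx UJU); rewrite !trmx_mul trmxK Gsym trmx0 !mulmxA.
have JUT : (- (J *m U))^T = - (U^T *m J^T) by rewrite -trmx_mul linearN.
rewrite tr_row_mx JUT !mul_col_mx !mul_mx_row UU (scalar_mx_block n n 1).
rewrite /block_mx; congr (col_mx (row_mx _ _) (row_mx _ _)).
- by rewrite mulmxN mulmxA -(mulmxA U^T) UJU oppr0.
- by rewrite !mulNmx UJT oppr0.
- rewrite !mulNmx mulmxN opprK.
  by rewrite -[RHS]UU -[in RHS]JGJ !mulmxA.
Qed.

(* Gram-Schmidt: [k] orthonormal vectors and their images by [J] span at most
   [2k < 2n] dimensions, so that some vector is orthogonal to all of them. *)
Lemma unitary_basis_exists : exists F, unitary_basis J G F.
Proof.
have GJ_anti : (G *m J)^T = - (G *m J).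
  rewrite trmx_mul Gsym -[in RHS]JGJ -!mulmxA JJ !mulmxN mulmx1.
  by rewrite opprK.
(* A 1 by 1 matrix equals its transpose, and [G *m J] is antisymmetric, so u is orthogonal to J
   u. *)
have GJ0 (u : 'cV[R]_(n + n)) : u^T *m (G *m J) *m u = 0.
  have tr1 (a : 'M[R]_1) : a^T = a.
    by apply/matrixP => i j; rewrite mxE !ord1.
  have : (u^T *m (G *m J) *m u)^T = - (u^T *m (G *m J) *m u).
    by rewrite !trmx_mul trmxK -trmx_mul GJ_anti mulNmx mulmxN mulmxA.
  rewrite tr1; move: (_ *m u) => a /matrixP aN; apply/matrixP => i j.
  by move: (aN i j); rewrite !mxE => ?; lra.
have step k : (k <= n)%N -> exists U : 'M[R]_(n + n, k),
    U^T *m G *m U = 1%:M /\ U^T *m (G *m J) *m U = 0.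
  elim: k => [_|k IHk kn].
    by exists 0; split; apply/matrixP => -[].
  have [U [UU UJU]] := IHk (ltnW kn).
  (* A row annihilating [W] is orthogonal to the columns of [U] and of [J *m U]. As [W] has k + k <
     n + n columns, such a nonzero row exists. *)
  pose W := row_mx (G *m U) (G *m J *m U).
  have [u [u0 uW]] : exists u : 'rV[R]_(n + n), u != 0 /\ u *m W = 0.
    have : kermx W != 0.
      rewrite -mxrank_eq0 mxrank_ker subn_eq0 -ltnNge.
      apply: leq_ltn_trans (rank_leq_col _) _.
      by rewrite -addnS leq_add // ltnW.
    move=> /rowV0Pn [u /sub_kermxP uW u0].
    by exists u.
  have := Gpos (u := u^T); rewrite trmx_eq0 => /(_ u0); rewrite trmxK; set g := _ 0 0 => g0.
  pose v := (Num.sqrt g)^-1 *: u^T.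
  have vT : v^T = (Num.sqrt g)^-1 *: u by rewrite linearZ /= trmxK.
  have vv : v^T *m G *m v = 1%:M.
    rewrite vT /v -!scalemxAl -scalemxAr scalerA.
    apply/matrixP => i j; rewrite !ord1 mxE -/g -invfM -expr2 sqr_sqrtr ?ltW //.
    by rewrite mulVf ?gt_eqF // mxE eqxx.
  have vU : v^T *m (G *m U) = 0 /\ v^T *m (G *m J *m U) = 0.
    move: uW; rewrite mul_mx_row -row_mx0 => /eq_row_mx [h1 h2].
    by rewrite vT -!scalemxAl h1 h2 !scaler0.
  case: vU => vU vJU.
  have Uv : U^T *m G *m v = 0.
    by move: (congr1 trmx vU); rewrite !trmx_mul trmxK Gsym trmx0.
  have UJv : U^T *m (G *m J) *m v = 0.
    move: (congr1 trmx vJU); rewrite trmx_mul trmxK (trmx_mul _ U) GJ_anti trmx0.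
    by rewrite mulmxN mulNmx => /eqP; rewrite oppr_eq0 => /eqP.
  rewrite -addn1; exists (row_mx U v); rewrite tr_row_mx !mul_col_mx !mul_mx_row.
  have vU' : v^T *m G *m U = 0 by rewrite -mulmxA.
  have vJU' : v^T *m (G *m J) *m U = 0 by rewrite -mulmxA.
  rewrite UU Uv UJv UJU vv vU' vJU' GJ0; split; first by rewrite (scalar_mx_block k 1 1).
  by rewrite -[LHS]/(block_mx 0 0 0 0) block_mx0.
have [U [UU UJU]] := step n (leqnn n).
by exists (row_mx U (- (J *m U))); exact: unitary_basis_row.
Qed.

End UnitaryBasis.

(** * Unitary frames on the manifold *)

Definition gram (R : realType) (m : nat) (X : Type)
    (om : X -> 'cV[R]_m -> 'cV[R]_m -> R) (J : X -> 'M[R]_m) (q : X) : 'M[R]_m :=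
  \matrix_(i, j) gJ om J q (delta_mx i 0) (delta_mx j 0).

Section UnitaryFrame.
Variables (R : realType) (n : nat) (X : pointedType) (A : set (chart X 'cV[R]_(n + n))).
Variables (om : X -> 'cV[R]_(n + n) -> 'cV[R]_(n + n) -> R) (J : X -> 'M[R]_(n + n)).
Hypothesis symp : symplectic_form A om.
Hypothesis compJ : compatible_acs A om J.
Implicit Types (q : X) (u v : 'cV[R]_(n + n)).

Let omN q u v : om q (- u) v = - om q u v.
Proof.
have om0 : om q 0 v = 0.
  have := symplectic_linear symp q 1 0 0 v; rewrite scaler0 addr0 => h; lra.
by have := symplectic_linear symp q (-1) u 0 v; rewrite scaleN1r addr0 om0 => ->; ring.
Qed.

(** Linearity in the first argument comes from the form; the symmetry of the metric transfers it to
    the second. *)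
Lemma gJ_gram q u v : gJ om J q u v = (u^T *m gram om J q *m v) 0 0.
Proof.
have gP a u1 u2 w : gJ om J q (a *: u1 + u2) w = a * gJ om J q u1 w + gJ om J q u2 w.
  by rewrite /gJ mulmxDr -scalemxAr (symplectic_linear symp).
have g0 w : gJ om J q 0 w = 0.
  have := gP 1 0 0 w; rewrite scaler0 addr0 => h; lra.
have gsum (a : 'I_(n + n) -> R) w :
    gJ om J q (\sum_i a i *: delta_mx i 0) w = \sum_i a i * gJ om J q (delta_mx i 0) w.
  elim/big_rec2: _ => [|i x y _ <-]; [exact: g0 | by rewrite gP].
have vecE (w : 'cV[R]_(n + n)) : w = \sum_i w i 0 *: delta_mx i 0.
  by rewrite {1}(matrix_sum_delta w); apply: eq_bigr => i _; rewrite big_ord1.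
rewrite {1}[u]vecE gsum -mulmxA mxE; apply: eq_bigr => i _; rewrite !mxE; congr (_ * _).
rewrite (acs_sym compJ) {1}[v]vecE gsum; apply: eq_bigr => j _.
by rewrite mxE (acs_sym compJ) mulrC.
Qed.

Lemma gram_unique q (B : 'M[R]_(n + n)) :
  (forall u v, gJ om J q u v = (u^T *m B *m v) 0 0) -> B = gram om J q.
Proof.
move=> BE; apply/matrixP => i j; rewrite [RHS]mxE BE trmx_delta.
by rewrite -rowE -colE !mxE.
Qed.

Lemma gram_sym q : (gram om J q)^T = gram om J q.
Proof. by apply/matrixP => i j; rewrite !mxE (acs_sym compJ). Qed.

Lemma gram_J q : (J q)^T *m gram om J q *m J q = gram om J q.
Proof.
apply: gram_unique => u v.
transitivity (gJ om J q (J q *m u) (J q *m v)).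
  rewrite /gJ mulmxA (acs_square compJ) mulNmx mul1mx omN.
  by rewrite -(symplectic_antisym symp) -/(gJ om J q v u) (acs_sym compJ).
by rewrite gJ_gram trmx_mul !mulmxA.
Qed.

Lemma gram_pos q u : u != 0 -> 0 < (u^T *m gram om J q *m u) 0 0.
Proof. by move=> u0; rewrite -gJ_gram; apply: (acs_pos compJ). Qed.

(** A frame lists no condition on the products of the v_i among themselves; [unitary_basis_row]
    recovers it from v_i = - J u_i. *)
Lemma unitary_frameP q F :
  unitary_frame om J q F <-> unitary_basis (J q) (gram om J q) F.
Proof.
have gcol (k l : nat) (U : 'M[R]_(n + n, k)) (V : 'M[R]_(n + n, l)) i j :
    gJ om J q (col i U) (col j V) = (U^T *m gram om J q *m V) i j.
  rewrite gJ_gram !colE trmx_mul trmx_delta -!mulmxA -rowE !mulmxA -colE.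
  by rewrite mxE mxE.
split=> [[_ Fv Fuu Fuv]|uF].
  have FvE : rsubmx F = - (J q *m lsubmx F).
    apply/matrixP => i j.
    have := congr1 (fun c : 'cV_(n + n) => c i 0) (Fv j); rewrite !mxE => ->.
    by congr (- _); apply: eq_bigr => k _; rewrite !mxE.
  have colL i : col (lshift n i) F = col i (lsubmx F).
    by apply/colP => k; rewrite !mxE.
  have colR i : col (rshift n i) F = col i (rsubmx F).
    by apply/colP => k; rewrite !mxE.
  rewrite -[F]hsubmxK FvE.
  apply: unitary_basis_row; rewrite ?gram_sym ?gram_J //; first exact: (acs_square compJ).
    by apply/matrixP => i j; rewrite -gcol -!colL Fuu mxE.
  have : (lsubmx F)^T *m gram om J q *m rsubmx F = 0.
    by apply/matrixP => i j; rewrite -gcol -colL -colR Fuv mxE.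
  by rewrite FvE mulmxN => /eqP; rewrite oppr_eq0 => /eqP; rewrite !mulmxA.
split.
- exact: unitary_basis_unit uF.
- move=> i; case: uF => /(congr1 (col (lshift n i))) + _.
  rewrite colE -mulmxA -colE => ->.
  rewrite -[F]hsubmxK; move: (lsubmx F) (rsubmx F) => U V.
  rewrite /std_J mul_row_block !(mulmx0, mulmx1, mulmxN, addr0, add0r) colKl colKr.
  by rewrite linearN opprK.
- by move=> i j; rewrite gcol (proj2 uF) mxE (inj_eq (@lshift_inj _ _)).
- by move=> i j; rewrite gcol (proj2 uF) mxE eq_lrshift.
Qed.

Lemma unitary_frameM q F (C : 'M[R[i]]_n) : unitary_frame om J q F ->
  C \is unitarymx -> unitary_frame om J q (F *m realify C).
Proof. by move=> /unitary_frameP uF Cu; apply/unitary_frameP/unitary_basisM. Qed.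

Lemma unitary_frame_exists q : exists F, unitary_frame om J q F.
Proof.
have [F uF] := unitary_basis_exists (acs_square compJ q) (gram_sym q) (gram_J q)
  (@gram_pos q).
by exists F; exact/unitary_frameP.
Qed.

End UnitaryFrame.

(** * Determinants of unitary matrices and the inherent circle action *)

Lemma unitarymxM (R : realType) (n : nat) (C D : 'M[R[i]]_n) :
  C \is unitarymx -> D \is unitarymx -> C *m D \is unitarymx.
Proof. exact: (@mul_unitarymx R[i] n n n C D). Qed.

Lemma unitarymxV (R : realType) (n : nat) (C : 'M[R[i]]_n) :
  C \is unitarymx -> invmx C \is unitarymx.
Proof. by move=> Cu; rewrite (invmx_unitary Cu) trmxC_unitary. Qed.

Lemma unitarymx1 (R : realType) (n : nat) : (1%:M : 'M[R[i]]_n) \is unitarymx.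
Proof. by apply/unitarymxP; rewrite trmx1 map_mx1 mulmx1. Qed.

Lemma unitary_det_circle (R : realType) (n : nat) (C : 'M[R[i]]_n) :
  C \is unitarymx -> circle (\det C).
Proof.
move=> /unitarymxP /(congr1 determinant); rewrite det_mulmx det_map_mx det_tr det1.
rewrite -normCK => /eqP; rewrite -[1](expr1n _ 2) eqrXn2 ?normr_ge0 ?ler01 //.
by move/eqP.
Qed.

Lemma circleM (R : realType) (z z' : R[i]) : circle z -> circle z' -> circle (z * z').
Proof. by rewrite /circle /= normrM => -> ->; rewrite mulr1. Qed.

(** The witness is diag(e(t/2), 1, .., 1), the half angle compensating for the square; a first
    diagonal entry is available because n > 0. *)
Lemma unitary_det_exists (R : realType) (n : nat) (z : R[i]) : (0 < n)%N ->
  circle z -> exists2 D : 'M[R[i]]_n, D \is unitarymx & \det D ^+ 2 = z.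
Proof.
case: n => // n _ /circle_expiE [t ->].
pose c : R[i] := expi (t / 2).
have cc : c * c^*%R = 1 by rewrite -normCK circle_expi expr1n.
pose d : 'rV[R[i]]_n.+1 := \row_j (if j == ord0 then c else 1).
exists (diag_mx d).
  apply/unitarymxP; rewrite tr_diag_mx map_diag_mx mulmx_diag -diag_const_mx.
  congr diag_mx; apply/rowP => j; rewrite !mxE.
  by case: ifP => _; rewrite ?cc // rmorph1 mulr1.
rewrite det_diag big_ord_recl big1 => [|i _]; last by rewrite mxE.
by rewrite mxE eqxx mulr1 expr2 -expiD; congr expi; lra.
Qed.

Section GammaAct.
Variables (R : realType) (n : nat) (X : Type).
Implicit Types (q : X) (F : 'M[R]_(n + n)) (z : R[i]) (C D : 'M[R[i]]_n).

(** Elements of [EU] have squared determinant 1, so they can be absorbed into the acting matrix and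
    a single representative [F] suffices. *)
Lemma gamma_act_class q F z : gamma_act (frame_class q F) z =
  [set (q, F *m realify C) | C in [set C : 'M[R[i]]_n | C \is unitarymx /\ \det C ^+ 2 = z]].
Proof.
apply/seteqP; split=> [f [_ [C [[E [Eu Edet] <-] Cu Cz ->]]]|_ [C [Cu Cz] <-]].
  exists (E *m C); last by rewrite realifyM mulmxA.
  split; first exact: (unitarymxM Eu Cu).
  rewrite det_mulmx exprMn Cz; case: Edet => ->; rewrite ?sqrrN expr1n mul1r //.
exists (q, F), C; split=> //.
exists 1%:M; last by rewrite realify1 mulmx1.
by split; [exact: unitarymx1 | left; rewrite det1].
Qed.

(** Two unitary matrices with the same squared determinant differ by an element of [EU], since x^2 =
    1 leaves only 1 and -1. *)
Lemma gamma_act_unitary q F D : D \is unitarymx ->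
  gamma_act (frame_class q F) (\det D ^+ 2) = frame_class q (F *m realify D).
Proof.
move=> Du; have Dd : \det D != 0.
  by rewrite -unitfE -unitmxE unitarymx_unit.
rewrite gamma_act_class; apply/seteqP; split=> [_ [C [Cu Cz] <-]|_ [E [Eu Edet] <-]].
  exists (invmx D *m C); last by rewrite -mulmxA -realifyM mulKVmx // unitarymx_unit.
  split.
    exact: (unitarymxM (unitarymxV Du) Cu).
  have /eqP : \det (invmx D *m C) ^+ 2 = 1.
    by rewrite det_mulmx exprMn Cz det_inv -exprMn mulVf // expr1n.
  by rewrite sqrf_eq1 => /orP[/eqP ->|/eqP ->]; [left|right].
exists (D *m E); last by rewrite realifyM mulmxA.
split; first exact: (unitarymxM Du Eu).
by rewrite det_mulmx exprMn; case: Edet => ->; rewrite ?sqrrN expr1n mulr1.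
Qed.

Lemma gamma_act1 q F : gamma_act (frame_class q F) 1 = frame_class q F.
Proof.
have := gamma_act_unitary q F (@unitarymx1 R n).
by rewrite det1 expr1n realify1 mulmx1.
Qed.

Lemma gamma_actM q F z z' : (0 < n)%N -> circle z -> circle z' ->
  gamma_act (gamma_act (frame_class q F) z) z' = gamma_act (frame_class q F) (z * z').
Proof.
move=> n0 /(unitary_det_exists n0)[D Du <-] /(unitary_det_exists n0)[D' D'u <-].
rewrite gamma_act_unitary // gamma_act_unitary // -exprMn -det_mulmx gamma_act_unitary.
  by rewrite realifyM mulmxA.
exact: (unitarymxM Du D'u).
Qed.

(** An invertible frame has trivial stabilizer, so one matrix D lies in both descriptions and z =
    (det D)^2 = z'. *)
Lemma gamma_act_inj q F z z' : (0 < n)%N -> F \in unitmx -> circle z ->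
  gamma_act (frame_class q F) z = gamma_act (frame_class q F) z' -> z = z'.
Proof.
move=> n0 Fu /(unitary_det_exists n0)[D Du <-]; rewrite !gamma_act_class => E.
have : [set (q, F *m realify C) | C in
    [set C : 'M[R[i]]_n | C \is unitarymx /\ \det C ^+ 2 = z']] (q, F *m realify D).
  by rewrite -E; exists D.
move=> [C [_ <-] [/(can_inj (mulKmx Fu)) /realify_inj ->]] //.
Qed.

End GammaAct.

(** * The lifted action over a fixed point *)

Lemma push_frame_mulmx (R : realType) (n : nat) (X : pointedType)
    (A : set (chart X 'cV[R]_(n + n))) (phi : X -> X) (q : X) (L F : 'M[R]_(n + n)) :
  (forall v, tangent_map A phi q v = L *m v) ->
  \matrix_(i, j) tangent_map A phi q (col j F) i 0 = L *m F.
Proof.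
move=> LE; apply/matrixP => i j.
by rewrite mxE LE !mxE; apply: eq_bigr => k _; rewrite !mxE.
Qed.

Section LiftedAction.
Variables (R : realType) (n : nat) (M : ptopologicalType).
Variables (A : set (chart M 'cV[R]_(n + n))).
Variables (om : M -> 'cV[R]_(n + n) -> 'cV[R]_(n + n) -> R).
Variables (J0 J : M -> 'M[R]_(n + n)) (Psi : M -> 'M[R]_(n + n) -> 'M[R]_(n + n)).
Hypothesis symp : symplectic_form A om.
Hypothesis compJ0 : compatible_acs A om J0.
Hypothesis compJ : compatible_acs A om J.
Hypothesis isoPsi : frame_bundle_iso A om J0 J Psi.

(** U(n) is transitive on the frames at a point, so a single value of [Psi] reaches all of them. *)
Lemma frame_iso_surj q F F0 : unitary_frame om J q F -> unitary_frame om J0 q F0 ->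
  exists2 C : 'M[R[i]]_n, C \is unitarymx & F = Psi q F0 *m realify C.
Proof.
move=> uF uF0; have uPF := frame_iso_frame isoPsi uF0.
have [Cu FE] := unitary_basis_trans (proj1 (unitary_frameP symp compJ q _) uPF)
  (proj1 (unitary_frameP symp compJ q _) uF).
by eexists; [exact: Cu | exact: FE].
Qed.

Lemma lifted_action_class (Phi : R[i] -> M -> M) (z : R[i]) (p : M)
    (L F0 : 'M[R]_(n + n)) (C : 'M[R[i]]_n) :
  Phi z p = p -> (forall v, tangent_map A (Phi z) p v = L *m v) ->
  unitary_frame om J0 p F0 -> C \is unitarymx -> L *m F0 = F0 *m realify C ->
  lifted_action A om J0 Psi Phi z (frame_class p (Psi p F0)) =
  gamma_act (frame_class p (Psi p F0)) (\det C ^+ 2).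
Proof.
move=> fixp LE uF0 Cu LF; rewrite gamma_act_unitary //.
have Pu : Psi p F0 \in unitmx := frame_basis (frame_iso_frame isoPsi uF0).
have key E : E \is unitarymx ->
    Psi p (L *m (F0 *m realify E)) = Psi p F0 *m realify C *m realify E.
  move=> Eu; rewrite mulmxA LF -mulmxA -realifyM.
  by rewrite (frame_iso_equiv isoPsi uF0 (unitarymxM Cu Eu)) realifyM mulmxA.
rewrite /lifted_action; apply/seteqP; split.
  move=> _ [[q F1] /= [uF1 [E [Eu Edet] [qE FE]]] <-].
  subst q; rewrite (push_frame_mulmx _ LE) fixp.
  have [Du F1E] := unitary_basis_trans (proj1 (unitary_frameP symp compJ0 p _) uF0)
    (proj1 (unitary_frameP symp compJ0 p _) uF1).
  move: Du F1E; set D := complexify _ => Du F1E.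
  (* Equivariance makes [Psi] injective on the fiber: the unknown frame is F0 D, its image is both
     Psi(F0) D and Psi(F0) E, hence D = E. *)
  move: FE; rewrite F1E (frame_iso_equiv isoPsi) // => /(can_inj (mulKmx Pu)) /realify_inj ED.
  by exists E => //; rewrite -ED key.
move=> _ [E [Eu Edet] <-]; exists (p, F0 *m realify E) => /=.
  split.
    exact: (unitary_frameM symp compJ0).
  by exists E => //; rewrite (frame_iso_equiv isoPsi).
by rewrite (push_frame_mulmx _ LE) fixp key.
Qed.

End LiftedAction.

(** * Velocities and integrals along the fiber *)

Section GammaVelocity.
Variables (R : realType) (n : nat) (M : ptopologicalType).
Variables (A : set (chart M 'cV[R]_(n + n))).
Variables (om : M -> 'cV[R]_(n + n) -> 'cV[R]_(n + n) -> R) (J : M -> 'M[R]_(n + n)).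
Hypothesis n_gt0 : (0 < n)%N.
Hypothesis symp : symplectic_form A om.
Hypothesis compJ : compatible_acs A om J.

(** In every chart of [gamma_atlas] around the point, the base coordinate is constant and the angle
    is affine of slope [k], so the chart selected by [chart_at] does not matter. *)
Lemma velocity_fiber (p : M) (F : 'M[R]_(n + n)) (k t0 : R) :
  let g t := gamma_act (frame_class p F) (expi (k * t)) in
  (exists d, gamma_atlas A om J d /\ cdom d (g t0)) ->
  velocity (gamma_atlas A om J) g t0 = (0, k).
Proof.
move=> g /getPex; rewrite /velocity -/(chart_at (gamma_atlas A om J) (g t0)).
set d := chart_at _ _ => -[].
move=> [c [U [s [a /= [Ac _ _ _ [domE funE _]]]]]].
rewrite domE => -[q [theta [Uq Itheta gq]]].
have [D Du Ddet] := unitary_det_exists n_gt0 (circle_expi (k * t0)).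
have qp : q = p.
  have : g t0 (p, F *m realify D).
    by rewrite /g gamma_act_class; exists D.
  by rewrite gq gamma_act_class => -[C _ [->]].
subst q.
have gE t : g t = gamma_act (frame_class p (s p)) (expi (theta + k * (t - t0))).
  rewrite expiD -(gamma_actM _ _ n_gt0 (circle_expi _) (circle_expi _)) -gq /g.
  rewrite (gamma_actM _ _ n_gt0 (circle_expi _) (circle_expi _)) -expiD.
  by congr (gamma_act _ (expi _)); ring.
(* The difference quotient already equals (0, k) as soon as h is small enough for the angle to stay
   in the open window of the chart. *)
rewrite /derive1; apply: (lim_near_cst (@norm_hausdorff R (gamma_model R n))).
have near1 : \forall h \near (0 : R)^', theta + k * h \in `]a, a + 1[.
  apply: nbhs_dnbhs.
  have : (fun h : R => theta + k * h) @ (0 : R) --> theta + k * 0.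
    by apply: cvgD; [exact: cvg_cst | apply: cvgM; [exact: cvg_cst | exact: cvg_id]].
  move=> /(_ [set` `]a, a + 1[]); apply.
  by apply: near_in_itvoo; rewrite in_itv /= mulr0 addr0.
near=> h.
have Ih : a < theta + k * h < a + 1.
  by rewrite -[_ < _ < _]/(theta + k * h \in `]a, a + 1[); near: h.
have h0 : h != 0 by near: h; exact: nbhs_dnbhs_neq.
rewrite /= !gE addrK subrr mulr0 addr0 !funE //.
congr pair; first by rewrite /= subrr scaler0.
by rewrite /= addrAC subrr add0r /GRing.scale /= mulrCA mulVf // mulr1.
Unshelve. all: by end_near.
Qed.

(** The velocity is [k] times [d_theta], where the connection form takes the value 1; the integrand
    is the constant [k] on an interval of length 1. *)
Lemma orbit_integral_fiber (f : set (framed R n M) -> gamma_model R n -> R)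
    (lift : R[i] -> set (framed R n M) -> set (framed R n M))
    (p : M) (F : 'M[R]_(n + n)) (k : R) :
  connection_form A om J f -> unitary_frame om J p F ->
  (forall t, lift (expi t) (frame_class p F) = gamma_act (frame_class p F) (expi (k * t))) ->
  orbit_integral A om J lift f (frame_class p F) = k.
Proof.
move=> cf uF liftE.
pose g t := gamma_act (frame_class p F) (expi (k * t)).
have fg t : f (g t) (velocity (gamma_atlas A om J) g t) = k.
  pose At := gamma_atlas A om J.
  have [D Du Ddet] := unitary_det_exists n_gt0 (circle_expi (k * t)).
  have gt : g t = frame_class p (F *m realify D) by rewrite /g -Ddet gamma_act_unitary.
  have ggt : gamma om J (g t).
    rewrite gt; exists p => //; exists (F *m realify D) => //.
    exact: (unitary_frameM symp compJ).
  have dth1 := connection_d_theta cf ggt.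
  have dthE : (exists d, At d /\ cdom d (g t)) -> d_theta A om J (g t) = (0, 1).
    move=> ex; rewrite /d_theta gt.
    have -> : (fun u => gamma_act (frame_class p (F *m realify D)) (expi u)) =
        (fun u => gamma_act (frame_class p (F *m realify D)) (expi (1 * u))).
      by apply/funext => u; rewrite mul1r.
    by apply: velocity_fiber; rewrite mulr0 expi0 gamma_act1 -gt.
  have f0 : f (g t) 0 = 0.
    have := connection_linear cf 1 0 0 ggt; rewrite scaler0 addr0 => ?; lra.
  (* Where the atlas has no chart, [d_theta] takes the junk value [0], which
     contradicts [f (d_theta) = 1]; no smooth local frame has to be built. *)
  have ex : exists d, At d /\ cdom d (g t).
    apply: contrapT => nex; have := dth1; rewrite /d_theta /velocity.
    rewrite expi0 gt gamma_act1 -gt /chart_at getPN; last first.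
      by move=> d hd; apply: nex; exists d.
    rewrite (_ : _ \o _ = cst 0); last exact/funext.
    by rewrite derive1_cst f0 => /esym/eqP; rewrite oner_eq0.
  rewrite velocity_fiber //.
  have -> : (0, k) = k *: d_theta A om J (g t) + 0 :> gamma_model R n.
    by rewrite dthE // addr0; congr pair; rewrite /= ?scaler0 // /GRing.scale /= mulr1.
  by rewrite (connection_linear cf) // dth1 f0 mulr1 addr0.
have gE : (fun t => lift (expi t) (frame_class p F)) = g by exact/funext.
rewrite /orbit_integral gE.
transitivity (\int[lebesgue_measure]_(t in `[0, 1]) k).
  by apply: eq_Rintegral => t _; rewrite liftE; exact: fg.
rewrite Rintegral_cst //= lebesgue_measure_itv /= lte_fin ltr01.
by rewrite -EFinD subr0 mulr1.
Qed.

End GammaVelocity.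

(** * The isotropy representation at a fixed point *)

Section TangentAtFixedPoint.
Variables (R : realType) (m : nat) (M : ptopologicalType).
Variables (A : set (chart M 'cV[R]_m)).
Variables (om : M -> 'cV[R]_m -> 'cV[R]_m -> R) (Phi : R[i] -> M -> M) (p : M).
Hypothesis manM : smooth_manifold A.
Hypothesis actPhi : symplectic_action A om Phi.
Hypothesis fixp : forall z : R[i], circle z -> Phi z p = p.

Let c := chart_at A p.
Let cp := cfun c p.
Let phi (t : R) (x : 'cV[R]_m) : 'cV[R]_m := cfun c (Phi (expi t) (cinv c x)).
(** Time and space together: derivatives in t of the differential at p become second derivatives of
    [F], which joint smoothness controls. *)
Let F (tx : (R^o * 'cV[R]_m)%type) : 'cV[R]_m := phi (tx.1 : R) tx.2.

Let cP : A c /\ cdom c p.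
Proof.
apply: (@getPex _ [set d | A d /\ cdom d p]).
by have [d] := manifold_cover manM p; exists d.
Qed.

Let cinv_cp : cinv c cp = p.
Proof. by case: cP => Ac cdp; exact: (manifold_inv manM Ac cdp). Qed.

Let Phip t : Phi (expi t) p = p.
Proof. by apply: fixp; exact: circle_expi. Qed.

Let phi_cp t : phi t cp = cp.
Proof. by rewrite /phi cinv_cp Phip. Qed.

Let F_domain (t : R) : cimg c cp /\ cdom c (Phi (expi t) (cinv c cp)).
Proof. by case: cP => Ac cdp; rewrite cinv_cp Phip; split=> //; exists p. Qed.

Let F_smooth (t : R) : differentiable F (t, cp) /\
  forall v, differentiable (fun y => 'D_v F y) (t, cp).
Proof.
(* Order 2 provides one derivative in space for the tangent map and one more in time. *)
case: cP => Ac cdp; have := action_smooth actPhi Ac Ac => /(_ 2%N) [F1 F2].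
split; first exact: (F1 (t, cp) (F_domain t)).
by move=> v; case: (F2 v) => F3 _; exact: (F3 (t, cp) (F_domain t)).
Qed.

Let phi_differentiable (t : R) : differentiable (phi t) cp.
Proof.
have -> : phi t = F \o (fun x : 'cV[R]_m => ((t : R^o), x)) by [].
apply: differentiable_comp; last exact: (F_smooth t).1.
by apply: differentiable_pair; [exact: differentiable_cst | exact: ex_diff].
Qed.

Let tangent_phi t v : tangent_map A (Phi (expi t)) p v = 'D_v (phi t) cp.
Proof. by rewrite /tangent_map Phip. Qed.

Let derive_phi (t : R) (v : 'cV[R]_m) : 'D_v (phi t) cp = 'D_((0 : R^o), v) F (t, cp).
Proof.
rewrite /derive; set d := (fun h => _ *: (_ - F _)).
suff -> : d = (fun h => h^-1 *: ((phi t \o shift cp) (h *: v) - phi t cp)) by [].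
by apply/funext => h; rewrite /d /F /= scaler0 add0r.
Qed.

Lemma tangent_linear t : exists L : 'M[R]_m,
  forall v, tangent_map A (Phi (expi t)) p v = L *m v.
Proof.
exists (\matrix_(i, j) (tangent_map A (Phi (expi t)) p (delta_mx j 0)) i 0) => v.
rewrite tangent_phi deriveE //.
have {1}-> : v = \sum_j v j 0 *: delta_mx j 0.
  by rewrite {1}(matrix_sum_delta v); apply: eq_bigr => i _; rewrite big_ord1.
rewrite linear_sum; apply/colP => i; rewrite summxE mxE; apply: eq_bigr => j _.
by rewrite linearZ !mxE tangent_phi deriveE // mulrC.
Qed.

(** This is the chain rule in the single chart [c]; by continuity the intermediate point stays in
    its domain for x near [cp], so the group law holds there in coordinates. *)
Lemma tangentM s t v : tangent_map A (Phi (expi (s + t))) p v =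
  tangent_map A (Phi (expi s)) p (tangent_map A (Phi (expi t)) p v).
Proof.
rewrite !tangent_phi.
have near_phi : \forall x \near cp, phi (s + t) x = (phi s \o phi t) x.
  case: cP => Ac cdp.
  have cdom_p : nbhs p (cdom c).
    by apply: open_nbhs_nbhs; split=> //; exact: (manifold_dom manM).
  have c1 : cinv c @ cp --> cinv c cp by exact: (manifold_cinv manM Ac (F_domain 0).1).
  have P1 : Phi (expi t) @ p --> Phi (expi t) p.
    have pair_t : (fun q : M => (t, q)) @ p --> (t, p).
      exact: (cvg_pair (cvg_cst t) cvg_id).
    exact: (cvg_comp _ _ pair_t (@action_continuous _ _ _ _ _ _ actPhi (t, p))).
  rewrite cinv_cp in c1; have Pc := cvg_comp _ _ c1 P1; rewrite Phip in Pc.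
  near=> x.
  have cx : cdom c (Phi (expi t) (cinv c x)).
    near: x; exact: (Pc _ cdom_p).
  rewrite /phi /= (manifold_inv manM Ac cx) expiD (actionM actPhi) //; exact: circle_expi.
have ds : differentiable (phi s) (phi t cp) by rewrite phi_cp.
have dst := differentiable_comp (phi_differentiable t) ds.
rewrite (near_eq_derive _ near_phi) (deriveE _ dst).
rewrite (diff_comp (phi_differentiable t) ds) phi_cp /=.
rewrite (deriveE _ (phi_differentiable t)).
by rewrite (deriveE _ (phi_differentiable s)).
Unshelve. all: by end_near.
Qed.

Lemma tangent_derivable v (t : R) :
  derivable (fun u : R => tangent_map A (Phi (expi u)) p v) t 1.
Proof.
have -> : (fun u : R => tangent_map A (Phi (expi u)) p v) =
    (fun y => 'D_((0 : R^o), v) F y) \o (fun u : R => ((u : R^o), cp)).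
  by apply/funext => u; rewrite tangent_phi derive_phi.
apply: diff_derivable; apply: differentiable_comp; last exact: (F_smooth t).2.
by apply: differentiable_pair; [exact: ex_diff | exact: differentiable_cst].
Qed.

End TangentAtFixedPoint.

(** * Derivability of complex-valued functions and of determinants *)

Section ComplexDerivable.
Variables (R : realType) (t : R).
Implicit Types f g : R -> R[i].

Definition cderivable f : Prop :=
  derivable (fun u => complex.Re (f u)) t 1 /\ derivable (fun u => complex.Im (f u)) t 1.

Lemma cderivable_cst (a : R[i]) : cderivable (fun=> a).
Proof. by split; exact: derivable_cst. Qed.

Lemma cderivableD f g : cderivable f -> cderivable g -> cderivable (fun u => f u + g u).
Proof.
move=> [fr fi] [gr gi]; split.
  have -> : (fun u => complex.Re (f u + g u)) =
      (fun u => complex.Re (f u)) + (fun u => complex.Re (g u)).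
    by apply/funext => u; rewrite fctE; case: (f u) (g u) => ? ? [].
  exact: (derivableD fr gr).
have -> : (fun u => complex.Im (f u + g u)) =
    (fun u => complex.Im (f u)) + (fun u => complex.Im (g u)).
  by apply/funext => u; rewrite fctE; case: (f u) (g u) => ? ? [].
exact: (derivableD fi gi).
Qed.

Lemma cderivableM f g : cderivable f -> cderivable g -> cderivable (fun u => f u * g u).
Proof.
move=> [fr fi] [gr gi]; split.
  have -> : (fun u => complex.Re (f u * g u)) =
      (fun u => complex.Re (f u)) * (fun u => complex.Re (g u))
      - (fun u => complex.Im (f u)) * (fun u => complex.Im (g u)).
    by apply/funext => u; rewrite !fctE; case: (f u) (g u) => ? ? [].
  exact: (derivableB (derivableM fr gr) (derivableM fi gi)).
have -> : (fun u => complex.Im (f u * g u)) =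
    (fun u => complex.Re (f u)) * (fun u => complex.Im (g u))
    + (fun u => complex.Im (f u)) * (fun u => complex.Re (g u)).
  by apply/funext => u; rewrite !fctE; case: (f u) (g u) => ? ? [].
exact: (derivableD (derivableM fr gi) (derivableM fi gr)).
Qed.

(** The Leibniz formula is a finite sum of finite products of entries; both are handled by induction
    on the index list. *)
Lemma cderivable_det n (C : R -> 'M[R[i]]_n) :
  (forall i j, cderivable (fun u => C u i j)) -> cderivable (fun u => \det (C u)).
Proof.
move=> dC; rewrite /determinant.
have dprod (s : 'I_n -> 'I_n) (r : seq 'I_n) : cderivable (fun u => \prod_(i <- r) C u i (s i)).
  elim: r => [|i r IHr].
    by under eq_fun do rewrite big_nil; exact: cderivable_cst.
  by under eq_fun do rewrite big_cons; exact: (cderivableM (dC _ _) IHr).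
elim: (index_enum _) => [|s r IHr].
  by under eq_fun do rewrite big_nil; exact: cderivable_cst.
under eq_fun do rewrite big_cons.
apply: cderivableD; last exact: IHr.
by apply: cderivableM; [exact: cderivable_cst | exact: dprod].
Qed.

End ComplexDerivable.

Lemma eq_mulmx_cV (R : pzRingType) (m n : nat) (A B : 'M[R]_(m, n)) :
  (forall v : 'cV[R]_n, A *m v = B *m v) -> A = B.
Proof.
move=> AB; apply/matrixP => i j; have := AB (delta_mx j 0).
by rewrite -!colE => /matrixP /(_ i 0); rewrite !mxE.
Qed.

(** * The character given by the squared determinant *)

Section Holonomy.
Variables (R : realType) (n : nat) (M : ptopologicalType).
Variables (A : set (chart M 'cV[R]_(n + n))).
Variables (om : M -> 'cV[R]_(n + n) -> 'cV[R]_(n + n) -> R).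
Variables (J0 : M -> 'M[R]_(n + n)) (Phi : R[i] -> M -> M) (p : M).
Hypothesis manM : smooth_manifold A.
Hypothesis symp : symplectic_form A om.
Hypothesis actPhi : symplectic_action A om Phi.
Hypothesis compJ0 : compatible_acs A om J0.
Hypothesis invJ0 : invariant_acs A Phi J0.
Hypothesis fixp : forall z : R[i], circle z -> Phi z p = p.

(** The isotropy map commutes with [J0] and preserves [om], hence preserves the metric built from
    them. *)
Lemma tangent_unitary_frame (t : R) (L F : 'M[R]_(n + n)) :
  (forall v, tangent_map A (Phi (expi t)) p v = L *m v) ->
  unitary_frame om J0 p F -> unitary_frame om J0 p (L *m F).
Proof.
move=> LE /(unitary_frameP symp compJ0)[JF GF].
have ct := circle_expi t.
have LJ : L *m J0 p = J0 p *m L.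
  by apply: eq_mulmx_cV => u; have := invJ0 p u ct; rewrite fixp // !LE !mulmxA.
have LG : L^T *m gram om J0 p *m L = gram om J0 p.
  apply: (gram_unique) => u v.
  have := action_symplectic actPhi p (J0 p *m u) v ct; rewrite fixp // !LE mulmxA LJ -mulmxA.
  rewrite -/(gJ om J0 p u v) -/(gJ om J0 p (L *m u) (L *m v)) => <-.
  by rewrite (gJ_gram symp compJ0) trmx_mul !mulmxA.
apply/(unitary_frameP symp compJ0); split.
  by rewrite mulmxA -LJ -!mulmxA JF.
rewrite trmx_mul -[RHS]GF -[in RHS]LG !mulmxA //.
Qed.

(* In a unitary frame at the fixed point, the isotropy representation is a
   differentiable one-parameter group [C] of unitary matrices. *)
Lemma isotropy_character (F0 : 'M[R]_(n + n)) : unitary_frame om J0 p F0 ->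
  exists (L : R -> 'M[R]_(n + n)) (C : R -> 'M[R[i]]_n) (k : int),
    forall t, [/\ forall v, tangent_map A (Phi (expi t)) p v = L t *m v,
      C t \is unitarymx, L t *m F0 = F0 *m realify (C t) &
      \det (C t) ^+ 2 = expi (k%:~R * t)].
Proof.
move=> uF0; have F0u := frame_basis uF0.
have [L LE] := choice (tangent_linear manM actPhi fixp).
pose C t := complexify (invmx F0 *m (L t *m F0)).
have CE t : C t \is unitarymx /\ L t *m F0 = F0 *m realify (C t).
  exact: (unitary_basis_trans (proj1 (unitary_frameP symp compJ0 p _) uF0)
    (proj1 (unitary_frameP symp compJ0 p _) (tangent_unitary_frame (LE t) uF0))).
have LM s t : L (s + t) = L s *m L t.
  apply: eq_mulmx_cV => v; have := tangentM manM actPhi fixp s t v.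
  by rewrite !LE mulmxA.
have CM s t : C (s + t) = C s *m C t.
  apply: (@realify_inj R n); apply: (can_inj (mulKmx F0u)).
  by rewrite -(CE _).2 LM realifyM mulmxA -(CE s).2 -!mulmxA -(CE t).2.
have zM s t : \det (C (s + t)) ^+ 2 = \det (C s) ^+ 2 * \det (C t) ^+ 2.
  by rewrite CM det_mulmx exprMn.
have zc t : circle (\det (C t) ^+ 2).
  by rewrite expr2; apply: circleM; exact: unitary_det_circle (CE t).1.
(* Times 0 and 1 give the same group element, and the value at 0 is a nonzero idempotent, hence
   1. *)
have z1 : \det (C 1) ^+ 2 = 1.
  have -> : C 1 = C 0.
    rewrite /C; congr (complexify (_ *m (_ *m _))); apply: eq_mulmx_cV => v.
    by rewrite -!LE expi0 expi1.
  have z0 : \det (C 0) != 0 by rewrite -unitfE -unitmxE unitarymx_unit // (CE 0).1.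
  apply: (mulfI (expf_neq0 2 z0)).
  by rewrite -zM addr0 mulr1.
have dC i j : cderivable (0 : R) (fun u => C u i j).
  have dK a b : derivable (fun u => (invmx F0 *m (L u *m F0)) a b) (0 : R) 1.
    (* Each entry is a constant linear combination of components of the isotropy map on a fixed
       frame vector, derivable in time. *)
    have -> : (fun u => (invmx F0 *m (L u *m F0)) a b) = \sum_(l < n + n)
        (fun u => invmx F0 a l * tangent_map A (Phi (expi u)) p (col b F0) l 0).
      rewrite fct_sumE; apply/funext => u; rewrite mxE; apply: eq_bigr => l _.
      by rewrite LE colE mulmxA -colE [in RHS]mxE.
    apply: derivable_sum => l; apply: derivableM; first exact: derivable_cst.
    have : derivable (fun u => tangent_map A (Phi (expi u)) p (col b F0)) (0 : R) 1.
      exact: (tangent_derivable manM actPhi fixp).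
    by move=> /derivable_mxP /(_ l 0).
  split.
    by under eq_fun do rewrite mxE /=; exact: dK.
  by under eq_fun do rewrite mxE /=; exact: dK.
have [dx dy] : cderivable (0 : R) (fun u => \det (C u) ^+ 2).
  have dd := cderivable_det dC.
  by under eq_fun do rewrite expr2; exact: (cderivableM dd dd).
have [k kE] := circle_characterE zc z1 zM dx dy.
exists L, C, k => t; split=> //; [exact: (CE t).1 | exact: (CE t).2].
Qed.

End Holonomy.

(** * The winding number of the lifted orbit *)

Theorem proposition24 (R : realType) (n : nat) (n_gt0 : (0 < n)%N)
  (M : ptopologicalType) (A : set (chart M 'cV[R]_(n + n)))
  (manM : smooth_manifold A)
  (om : M -> 'cV[R]_(n + n) -> 'cV[R]_(n + n) -> R)
  (symp : symplectic_form A om)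
  (J : M -> 'M[R]_(n + n)) (compJ : compatible_acs A om J)
  (Phi : R[i] -> M -> M) (actPhi : symplectic_action A om Phi)
  (J0 : M -> 'M[R]_(n + n)) (compJ0 : compatible_acs A om J0)
  (invJ0 : invariant_acs A Phi J0)
  (Psi : M -> 'M[R]_(n + n) -> 'M[R]_(n + n))
  (isoPsi : frame_bundle_iso A om J0 J Psi)
  (p : M) (fixp : forall z : R[i], circle z -> Phi z p = p) :
  let lift := lifted_action A om J0 Psi Phi in
  exists k : int,
    (forall f, connection_form A om J f ->
       maslov_data A om J lift f p = k%:~R) /\
    (forall w, gamma_fiber om J p w ->
       [/\ forall f, connection_form A om J f ->
             orbit_integral A om J lift f w = k%:~R,
           exists zeta : R[i] -> R[i],
             forall z, circle z ->
               circle (zeta z) /\ lift z w = gamma_act w (zeta z) &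
           forall zeta : R[i] -> R[i],
             (forall z, circle z ->
                circle (zeta z) /\ lift z w = gamma_act w (zeta z)) ->
             circle_degree zeta k]).
Proof.
move=> lift.
have [F0 uF0] := unitary_frame_exists symp compJ0 p.
have [L [C [k LC]]] := isotropy_character manM symp actPhi compJ0 invJ0 fixp uF0.
exists k.
have liftE F t : unitary_frame om J p F ->
    lift (expi t) (frame_class p F) = gamma_act (frame_class p F) (expi (k%:~R * t)).
  (* Any frame is Psi(F0 D) for a unitary D. In the frame F0 D the isotropy matrix is the conjugate
     of C_t by D, with the same determinant, so [k] serves the whole fiber. *)
  move=> uF; have [D Du FE] := frame_iso_surj symp compJ isoPsi uF uF0.
  have [LE Cu LF kE] := LC t.
  have Dunit := unitarymx_unit Du.
  have uF0D := unitary_frameM symp compJ0 uF0 Du.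
  rewrite FE -(frame_iso_equiv isoPsi) //.
  have Eu := unitarymxM (unitarymxM (unitarymxV Du) Cu) Du.
  have LFE : L t *m (F0 *m realify D) = F0 *m realify D *m realify (invmx D *m C t *m D).
    by rewrite mulmxA LF -!mulmxA -!realifyM mulKVmx.
  rewrite /lift (lifted_action_class symp compJ0 isoPsi (fixp _ (circle_expi t)) LE uF0D Eu LFE).
  have Dd : \det D != 0 by rewrite -unitfE -unitmxE.
  have -> : \det (invmx D *m C t *m D) = \det (C t).
    by rewrite !det_mulmx det_inv mulrAC mulVf ?mul1r.
  by rewrite kE.
have orbitE w f : gamma_fiber om J p w -> connection_form A om J f ->
    orbit_integral A om J lift f w = k%:~R.
  move=> [F uF <-] cf.
  by apply: (orbit_integral_fiber n_gt0 symp compJ) => // t; exact: liftE.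
split=> [f cf|w fw].
  (* An explicit point of the fiber ensures that [get] in [maslov_data] returns a genuine one. *)
  have fiber_p : gamma_fiber om J p (frame_class p (Psi p F0)).
    by exists (Psi p F0); [exact: (frame_iso_frame isoPsi uF0) |].
  exact: (orbitE _ _ (getPex (ex_intro _ _ fiber_p)) cf).
split; first by move=> f cf; exact: (orbitE _ _ fw cf).
  case: fw => F uF <-.
  (* Any choice of angle for z will do, since [liftE] holds at every real t; off the circle the
     value is arbitrary. *)
  have tauP (z : R[i]) : exists t : R, circle z -> z = expi t.
    case: (pselect (circle z)) => [cz|ncz]; last by exists 0 => /ncz.
    by have [t zt] := circle_expiE cz; exists t.
  have [tau tauE] := choice tauP.
  exists (fun z => expi (k%:~R * tau z)) => z cz; split; first exact: circle_expi.
  by rewrite {1}(tauE z cz) liftE.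
(* Freeness of the inherent action forces zeta(e(t)) = e(k t), so t -> k t is a continuous lift of
   increment k over a period. *)
case: fw => F uF <- zeta zetaE; exists (fun t => k%:~R * t); split.
- by move=> t; apply: cvgM; [exact: cvg_cst | exact: cvg_id].
- move=> t; have [zc zE] := zetaE _ (circle_expi t).
  apply: (gamma_act_inj (q := p) n_gt0 (frame_basis uF) zc).
  by rewrite -zE liftE.
- by rewrite mulr1 mulr0 subr0.
Qed.
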